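(* Let $n$ be a positive integer and let $Q\in\mathbb{C}^{n\times n}$ be an idempotent with $Q\ne 0_n$ and $Q\ne I_n$. Then $$\mathrm{ran}_Q=[\mathrm{min}_Q,\ \mathrm{max}_Q].$$
   Context: An idempotent is a matrix $Q$ with $Q^2=Q$; a projection is a Hermitian idempotent ($P=P^*=P^2$). $\mathcal{P}(\mathbb{C}^{n\times n})$ is the set of all projections in $\mathbb{C}^{n\times n}$, $\|\cdot\|_F$ is the Frobenius norm, and $I_n$, $0_n$ are the identity and zero matrices. For an idempotent $Q\in\mathbb{C}^{n\times n}$, $$\mathrm{ran}_Q=\big\{\|P-Q\|_F: P\in\mathcal{P}(\mathbb{C}^{n\times n})\big\},\quad \mathrm{min}_Q=\inf \mathrm{ran}_Q,\quad \mathrm{max}_Q=\sup\mathrm{ran}_Q.$$ *)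

(* Defs.v *)
From HB Require Import structures.
From mathcomp Require Import all_boot all_order all_algebra sesquilinear spectral.
From mathcomp Require Import complex.
From mathcomp Require Import boolp classical_sets set_interval reals.

Set Implicit Arguments.
Unset Strict Implicit.
Unset Printing Implicit Defensive.

Import Order.TTheory GRing.Theory Num.Theory.

Local Open Scope classical_set_scope.
Local Open Scope sesquilinear_scope.
Local Open Scope complex_scope.
Local Open Scope ring_scope.

Definition idempotent_mx (R : realType) (n : nat) (Q : 'M[R[i]]_n) : Prop :=
  Q *m Q = Q.

Definition projections (R : realType) (n : nat) : set 'M[R[i]]_n :=
  [set P | P ^t* = P /\ P *m P = P].

(* [normc] is used rather than [`| _ |] because the latter is [R[i]]-valued. *)
Definition frobenius_norm (R : realType) (m n : nat) (A : 'M[R[i]]_(m, n)) : R :=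
  Num.sqrt (\sum_(i < m) \sum_(j < n) ComplexField.Normc.normc (A i j) ^+ 2).

Definition ranQ (R : realType) (n : nat) (Q : 'M[R[i]]_n) : set R :=
  [set frobenius_norm (P - Q) | P in @projections R n].

(* [inf] and [sup] are genuine bounds here: [ranQ Q] contains the value at
   P = 0, and it is bounded because projections have norm at most sqrt n. *)
Definition minQ (R : realType) (n : nat) (Q : 'M[R[i]]_n) : R := inf (ranQ Q).

Definition maxQ (R : realType) (n : nat) (Q : 'M[R[i]]_n) : R := sup (ranQ Q).

(* Main.v *)
(** For a projection P and H = I - Q - Q^*, one has
    ||P - Q||_F^2 = ||Q||_F^2 + tr (P H).  In an orthonormal eigenbasis of the
    Hermitian matrix H, with eigenvalues r_i, the trace is sum_i r_i p_ii where
    0 <= p_ii <= 1; so it lies between the sum of the negative eigenvalues and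
    the sum of the positive ones.  A nonzero vector of the range of Q, resp. of
    its kernel, shows that some eigenvalue is negative, resp. positive.
    Given a set B of indices and two indices i, j outside B, the projections
    onto span (e_k, k in B) + span (sqrt t e_i + sqrt (1 - t) e_j) realize all
    values between r(B) + r_i and r(B) + r_j.  Adding the positive eigenvalues
    one at a time, with i a fixed negative index, covers all the values from 0
    to the maximum; exchanging signs covers the values from the minimum to 0. *)
Require Import Defs.
From HB Require Import structures.
From mathcomp Require Import all_boot all_order all_algebra sesquilinear spectral.
From mathcomp Require Import complex.
From mathcomp Require Import boolp classical_sets set_interval reals real_interval.
From mathcomp Require Import ring lra.

Set Implicit Arguments.
Unset Strict Implicit.
Unset Printing Implicit Defensive.

Import Order.TTheory GRing.Theory Num.Theory.

Local Open Scope classical_set_scope.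
Local Open Scope sesquilinear_scope.
Local Open Scope complex_scope.
Local Open Scope ring_scope.

(** * Adjoints, the Frobenius norm and diagonals of projections *)

Lemma conjC_real_complex (R : realType) (x : R) : (x%:C)^* = x%:C :> R[i].
Proof. by apply/CrealP; rewrite complex_real. Qed.

Lemma trmxC_mul (C : numClosedFieldType) m n p (A : 'M[C]_(m, n)) (B : 'M_(n, p)) :
  (A *m B) ^t* = B ^t* *m A ^t*.
Proof. by rewrite trmx_mul map_mxM. Qed.

Lemma trmxC_sub (C : numClosedFieldType) m n (A B : 'M[C]_(m, n)) :
  (A - B) ^t* = A ^t* - B ^t*.
Proof. by rewrite linearB /= map_mxB. Qed.

Lemma trmxC1 (C : numClosedFieldType) n : (1%:M : 'M[C]_n) ^t* = 1%:M.
Proof. by rewrite trmx1 map_mx1. Qed.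

Lemma mxtrace_mul_trmxC (R : realType) m n (A : 'M[R[i]]_(m, n)) :
  \tr (A *m A ^t*) = (frobenius_norm A ^+ 2)%:C.
Proof.
rewrite /frobenius_norm sqr_sqrtr; last first.
  by apply: sumr_ge0 => i _; apply: sumr_ge0 => j _; apply: sqr_ge0.
rewrite rmorph_sum; apply: eq_bigr => i _; rewrite mxE rmorph_sum.
by apply: eq_bigr => j _; rewrite !mxE -normCK rmorphXn.
Qed.

Lemma sqr_frobenius_norm_sub_projection (R : realType) n (P Q : 'M[R[i]]_n) :
  projections P ->
  frobenius_norm (P - Q) ^+ 2
    = frobenius_norm Q ^+ 2 + complex.Re (\tr (P *m (1%:M - Q - Q ^t*))).
Proof.
move=> [Pherm Pidem].
have -> (A : 'M[R[i]]_n) : frobenius_norm A ^+ 2 = complex.Re (\tr (A *m A ^t*)).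
  by rewrite mxtrace_mul_trmxC.
rewrite -[frobenius_norm Q ^+ 2]/(complex.Re (frobenius_norm Q ^+ 2)%:C).
rewrite -mxtrace_mul_trmxC -raddfD /=; congr complex.Re.
rewrite trmxC_sub Pherm !mulmxBr !mulmxBl mulmx1 Pidem !raddfB /=.
rewrite (mxtrace_mulC Q P); ring.
Qed.

Lemma projections_diag_itv (R : realType) n (P : 'M[R[i]]_n) k :
  projections P -> 0 <= complex.Re (P k k) <= 1.
Proof.
move=> [Pherm Pidem].
(* From P = P P^*, the entry [P k k] is the squared norm of row k. This sum is nonnegative and
   contains the term [P k k ^+ 2], whence [P k k <= 1]. *)
have Pkk : P k k = \sum_j `|P k j| ^+ 2.
  rewrite -[in LHS]Pidem -{2}Pherm mxE; apply: eq_bigr => j _.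
  by rewrite !mxE -normCK.
have Pkk_ge0 : 0 <= P k k by rewrite Pkk sumr_ge0 // => j _; apply: exprn_ge0.
have Pkk_le1 : P k k <= 1.
  have : P k k ^+ 2 <= P k k.
    rewrite -{1}(ger0_norm Pkk_ge0) [leRHS]Pkk (bigD1 k) //= lerDl sumr_ge0 //.
    by move=> j _; apply: exprn_ge0.
  move: Pkk_ge0; rewrite le_eqVlt => /predU1P[<- //|Pkk_gt0].
  by rewrite expr2 ger_pMl.
by move: Pkk_ge0 Pkk_le1; rewrite !lecE => /andP[_ ->] /andP[_ ->].
Qed.

Lemma projections_unitary_conj (R : realType) n (P U : 'M[R[i]]_n) :
  U \is unitarymx -> projections P -> projections (U *m P *m U ^t*).
Proof.
move=> Uunit [Pherm Pidem]; split; first by rewrite !trmxC_mul trmxCK Pherm mulmxA.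
rewrite !mulmxA -[U *m P *m _ *m _]mulmxA.
have := Uunit; rewrite -trmxC_unitary => /unitarymxP; rewrite trmxCK => ->.
by rewrite mulmx1 -[U *m P *m P]mulmxA Pidem.
Qed.

(** * Values of tr (P D) over projections P, for a real diagonal D *)

Definition weighted_diag (R : realType) n (r : 'I_n -> R) (P : 'M[R[i]]_n) : R :=
  \sum_k r k * complex.Re (P k k).

Lemma weighted_diagN (R : realType) n (r : 'I_n -> R) (P : 'M[R[i]]_n) :
  weighted_diag (fun k => - r k) P = - weighted_diag r P.
Proof. by rewrite -sumrN; apply: eq_bigr => k _; rewrite mulNr. Qed.

Lemma weighted_diag_le (R : realType) n (r : 'I_n -> R) (P : 'M[R[i]]_n) :
  projections P -> weighted_diag r P <= \sum_(k | 0 < r k) r k.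
Proof.
move=> Pproj; rewrite [leRHS]big_mkcond; apply: ler_sum => k _.
have := projections_diag_itv k Pproj; case: ltP => rk; nra.
Qed.

Lemma projections_map_real (R : realType) n (P : 'M[R]_n) :
  P^T = P -> P *m P = P -> projections (map_mx (real_complex R) P).
Proof.
move=> Psym Pidem; split; last by rewrite -map_mxM Pidem.
by apply/matrixP => i j; rewrite !mxE conjC_real_complex -[in RHS]Psym mxE.
Qed.

Lemma exists_projection_mix (R : realType) n (B : pred 'I_n) (i j : 'I_n) (t : R) :
  ~~ B i -> ~~ B j -> i != j -> 0 <= t <= 1 ->
  exists2 P : 'M[R[i]]_n, projections P &
    forall r, weighted_diag r P = \sum_(k | B k) r k + t * r i + (1 - t) * r j.
Proof.
move=> Bi Bj ij /andP[t0 t1].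
(* [w] is a unit vector orthogonal to the coordinates in [B], so [D + w^T *m w] is a projection; its
   diagonal is 1 on [B], t at i and 1 - t at j. *)
pose w : 'rV[R]_n := Num.sqrt t *: delta_mx 0 i + Num.sqrt (1 - t) *: delta_mx 0 j.
pose D : 'M[R]_n := diag_mx (\row_k (B k)%:R).
have wi : w 0 i = Num.sqrt t.
  by rewrite !mxE !eqxx (negPf ij) /= mulr1 mulr0 addr0.
have wj : w 0 j = Num.sqrt (1 - t).
  by rewrite !mxE !eqxx eq_sym (negPf ij) /= mulr1 mulr0 add0r.
have wk k : k != i -> k != j -> w 0 k = 0.
  by move=> ki kj; rewrite !mxE (negPf ki) (negPf kj) /= !mulr0 addr0.
clearbody w.
have sumw (f : 'I_n -> R) : \sum_k f k * w 0 k ^+ 2 = t * f i + (1 - t) * f j.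
  rewrite (bigD1 i) //= (bigD1 j) 1?eq_sym //= big1 => [|k /andP[ki kj]].
    by rewrite wi wj !sqr_sqrtr ?subr_ge0 // addr0 !(mulrC (f _)).
  by rewrite wk // expr0n mulr0.
have wwT : w *m w^T = 1%:M.
  apply/matrixP => a b; rewrite !ord1 !mxE /=.
  transitivity (\sum_k 1 * w 0 k ^+ 2).
    by apply: eq_bigr => k _; rewrite [w^T _ _]mxE mul1r.
  by rewrite (sumw (fun=> 1)) !mulr1 addrC subrK.
have wD : w *m D = 0.
  apply/matrixP => a b; rewrite ord1 mul_mx_diag !mxE.
  have [->|bi] := eqVneq b i; first by rewrite (negPf Bi) mulr0.
  have [->|bj] := eqVneq b j; first by rewrite (negPf Bj) mulr0.
  by rewrite wk // mul0r.
have DwT : D *m w^T = 0.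
  by apply: trmx_inj; rewrite trmx_mul trmxK tr_diag_mx trmx0.
have DD : D *m D = D.
  rewrite mulmx_diag; congr diag_mx; apply/rowP => k; rewrite !mxE.
  by case: (B k); rewrite ?mulr1 ?mulr0.
exists (map_mx (real_complex R) (D + w^T *m w)).
  apply: projections_map_real.
    by rewrite linearD /= trmx_mul trmxK tr_diag_mx.
  rewrite mulmxDl !mulmxDr DD (mulmxA D) DwT mul0mx addr0.
  by rewrite -!mulmxA wD mulmx0 add0r (mulmxA w) wwT mul1mx.
move=> r; rewrite /weighted_diag -addrA -sumw (big_mkcond B) -big_split /=.
apply: eq_bigr => k _; rewrite !mxE big_ord1 [w^T _ _]mxE eqxx mulr1n.
by case: (B k); rewrite /= expr2; ring.
Qed.

(** Induction on the list [s] of positive indices: when j is added, the values not yet covered lie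
    between S and S + r j, where S is the sum over [s]. Mixing a and j over [s] covers them, since S
    + r a < S. *)
Lemma weighted_diag_attained_ge0 (R : realType) n (r : 'I_n -> R) a v :
  r a < 0 -> 0 <= v <= \sum_(k | 0 < r k) r k ->
  exists2 P : 'M[R[i]]_n, projections P & weighted_diag r P = v.
Proof.
move=> ra; rewrite -big_filter; set s := filter _ _.
have : uniq s by rewrite filter_uniq // index_enum_uniq.
have : all (fun k => 0 < r k) s by apply: filter_all.
elim: s => [|j s IHs] /=.
  rewrite big_nil => _ _ v0; exists 0.
    by split; rewrite ?mulmx0 // trmx0 map_mx0.
  rewrite /weighted_diag big1 => [|k _]; last by rewrite mxE mulr0.
  by apply/eqP; rewrite eq_le.
move=> /andP[rj rs] /andP[js us]; rewrite big_cons => /andP[v0 vle].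
have [vles|vgts] := leP v (\sum_(k <- s) r k); first by apply: IHs; rewrite ?v0.
have as_ : a \notin s.
  by apply: contraTN ra => /(allP rs) ra; rewrite -leNgt ltW.
have aj : a != j by apply: contraTneq ra => ->; rewrite -leNgt ltW.
have d0 : 0 < r j - r a by lra.
set S := \sum_(k <- s) r k in vle vgts.
(* The solution of S + t * r a + (1 - t) * r j = v. *)
pose t := (S + r j - v) / (r j - r a).
have t01 : 0 <= t <= 1.
  by apply/andP; split; [apply: divr_ge0|rewrite ler_pdivrMr // mul1r]; lra.
have [P Pproj Pval] := exists_projection_mix (B := mem s) as_ js aj t01.
exists P => //; rewrite Pval -big_uniq //= -/S.
have : t * (r j - r a) = S + r j - v by rewrite divfK // gt_eqF.
lra.
Qed.

Lemma sum_pos_ge0 (R : realType) n (r : 'I_n -> R) : 0 <= \sum_(k | 0 < r k) r k.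
Proof. by apply: sumr_ge0 => k /ltW. Qed.

Lemma weighted_diag_attained (R : realType) n (r : 'I_n -> R) a b v :
  r a < 0 -> 0 < r b ->
  - (\sum_(k | 0 < - r k) - r k) <= v <= \sum_(k | 0 < r k) r k ->
  exists2 P : 'M[R[i]]_n, projections P & weighted_diag r P = v.
Proof.
move=> ra rb /andP[lev vle]; have [v0|v0] := leP 0 v.
  by apply: weighted_diag_attained_ge0 ra _; rewrite v0.
(* For v < 0, negate the weights: b is then the fixed negative index. *)
have [||P Pproj Pv] := @weighted_diag_attained_ge0 R n (fun k => - r k) b (- v).
- by rewrite oppr_lt0.
- by rewrite oppr_ge0 ltW //= lerNl.
by exists P => //; apply: oppr_inj; rewrite -weighted_diagN.
Qed.

(** * Diagonalization of Hermitian matrices *)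

Lemma hermitian_spectral (R : realType) n (A : 'M[R[i]]_n) : A ^t* = A ->
  exists U : 'M[R[i]]_n, exists r : 'I_n -> R,
    U \is unitarymx /\ A = U ^t* *m diag_mx (\row_k (r k)%:C) *m U.
Proof.
move=> Aherm.
have Ah : A \is hermsymmx.
  by apply/is_hermitianmxP; rewrite expr0 scale1r Aherm.
(* The spectral diagonal of a Hermitian matrix is real, so taking real parts loses nothing. *)
exists (spectralmx A), (fun k => complex.Re (spectral_diag A 0 k)).
split; first exact: spectral_unitarymx.
have /hermitian_normalmx/orthomx_spectralP {1}-> := Ah.
rewrite invmx_unitary ?spectral_unitarymx //; congr (_ *m diag_mx _ *m _).
apply/rowP => k; rewrite mxE; apply/esym/RRe_real.
exact/mxOverP/hermitian_spectral_diag_real.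
Qed.

Lemma mxtrace_mul_real_diag (R : realType) n (P : 'M[R[i]]_n) (r : 'I_n -> R) :
  complex.Re (\tr (P *m diag_mx (\row_k (r k)%:C))) = weighted_diag r P.
Proof.
rewrite mul_mx_diag /mxtrace raddf_sum; apply: eq_bigr => k _.
by rewrite !mxE; case: (P k k) => x y /=; rewrite mulr0 subr0 mulrC.
Qed.

(** The coordinates of x in the eigenbasis are [x *m U ^t*]; the trace only turns a 1 by 1 matrix
    into a scalar. *)
Lemma spectral_quadratic_form (R : realType) n (U : 'M[R[i]]_n) (r : 'I_n -> R)
    (x : 'rV_n) :
  \tr (x *m (U ^t* *m diag_mx (\row_k (r k)%:C) *m U) *m x ^t*)
    = \sum_k `|(x *m U ^t*) 0 k| ^+ 2 * (r k)%:C.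
Proof.
rewrite !mulmxA -mulmxA -[U *m _]trmxCK trmxC_mul trmxCK.
set y := x *m _; rewrite mul_mx_diag /mxtrace big_ord1 mxE.
by apply: eq_bigr => k _; rewrite !mxE normCK mulrAC.
Qed.

Lemma mxtrace_mul_trmxC_gt0 (R : realType) m n (A : 'M[R[i]]_(m, n)) :
  A != 0 -> 0 < \tr (A *m A ^t*).
Proof.
move=> A0; have ge0 i j : 0 <= `|A i j| ^+ 2 by apply: exprn_ge0.
have trE : \tr (A *m A ^t*) = \sum_i \sum_j `|A i j| ^+ 2.
  by apply: eq_bigr => i _; rewrite mxE; apply: eq_bigr => j _; rewrite !mxE -normCK.
have tr_ge0 : 0 <= \tr (A *m A ^t*).
  by rewrite trE; do 2![apply: sumr_ge0 => ? _].
rewrite lt_neqAle tr_ge0 andbT eq_sym; apply: contra A0 => /eqP.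
rewrite trE => /psumr_eq0P tr0; apply/eqP/matrixP => i j; rewrite mxE.
have /psumr_eq0P/(_ j isT)/eqP : \sum_j `|A i j| ^+ 2 = 0.
  by apply: tr0 => // k _; apply: sumr_ge0.
by rewrite expf_eq0 normr_eq0 => /(_ (fun k _ => ge0 i k))/eqP.
Qed.

(** * Eigenvalues of both signs *)

Lemma exists_row_neq0 (C : nzRingType) m n (A : 'M[C]_(m, n)) :
  A <> 0 -> exists k, row k A != 0.
Proof.
move=> A0; apply/existsP; apply: contra_notT A0 => /existsPn A0.
by apply/row_matrixP => k; rewrite row0; apply/eqP; have := A0 k; rewrite negbK.
Qed.

(** A nonzero row x of Q satisfies x Q = x, hence also x Q^* x^* = x x^*, and the quadratic form at
    x equals - x x^* < 0. It would be nonnegative if every r k were. *)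
Lemma exists_neg_eigenvalue (R : realType) n (Q U : 'M[R[i]]_n) (r : 'I_n -> R) :
  Q *m Q = Q -> Q <> 0 ->
  1%:M - Q - Q ^t* = U ^t* *m diag_mx (\row_k (r k)%:C) *m U ->
  exists k, r k < 0.
Proof.
move=> Qidem /exists_row_neq0[l]; set x := row l Q => x0 QE.
have xQ : x *m Q = x by rewrite -row_mul Qidem.
have xQx : x *m Q ^t* *m x ^t* = x *m x ^t* by rewrite -mulmxA -trmxC_mul xQ.
have := spectral_quadratic_form U r x; rewrite -QE.
rewrite !mulmxBr mulmx1 !mulmxBl xQ xQx subrr sub0r linearN /= => trE.
apply/existsP; apply: contraLR (mxtrace_mul_trmxC_gt0 x0) => /existsPn r0.
suff: 0 <= \sum_k `|(x *m U ^t*) 0 k| ^+ 2 * (r k)%:C.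
  by rewrite -oppr_lt0 trE => /le_gtF ->.
apply: sumr_ge0 => k _; rewrite mulr_ge0 ?exprn_ge0 // lecR.
by have := r0 k; rewrite -leNgt.
Qed.

(** Replacing Q by the nonzero idempotent I - Q changes I - Q - Q^* into its opposite. *)
Lemma exists_pos_eigenvalue (R : realType) n (Q U : 'M[R[i]]_n) (r : 'I_n -> R) :
  Q *m Q = Q -> Q <> 1%:M ->
  1%:M - Q - Q ^t* = U ^t* *m diag_mx (\row_k (r k)%:C) *m U ->
  exists k, 0 < r k.
Proof.
move=> Qidem Q1 QE.
have [|||k] := @exists_neg_eigenvalue R n (1%:M - Q) U (fun k => - r k).
- by rewrite mulmxBl !mulmxBr !mul1mx mulmx1 Qidem subrr subr0.
- by move/eqP; rewrite subr_eq0 => /eqP/esym.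
- have -> : (\row_k (- r k)%:C : 'rV[R[i]]_n) = - \row_k (r k)%:C.
    by apply/rowP => k; rewrite !mxE rmorphN.
  rewrite linearN mulmxN mulNmx -QE trmxC_sub trmxC1.
  by rewrite !opprB [1%:M + _]addrCA subrr addr0 addrCA.
- by rewrite oppr_lt0; exists k.
Qed.

(** * The range as a closed interval *)

Lemma eq_itvcc_inf_sup (R : realType) (A : set R) (x y : R) :
  x <= y -> A = `[x, y]%classic -> A = `[inf A, sup A]%classic.
Proof. by move=> xy ->; rewrite inf_itvcc ?sup_itvcc. Qed.

Theorem theorem4p5 (R : realType) (n : nat) (Q : 'M[R[i]]_n)
  (n_gt0 : (0 < n)%N) (idemQ : idempotent_mx Q) (Q_neq0 : Q <> 0)
  (Q_neq1 : Q <> 1%:M) :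
  ranQ Q = `[minQ Q, maxQ Q]%classic.
Proof.
pose H := 1%:M - Q - Q ^t*.
have Hherm : H ^t* = H by rewrite !trmxC_sub trmxC1 trmxCK addrAC.
have [U [r [Uunit HE]]] := hermitian_spectral Hherm.
have [a ra] := exists_neg_eigenvalue idemQ Q_neq0 HE.
have [b rb] := exists_pos_eigenvalue idemQ Q_neq1 HE.
set c := frobenius_norm Q ^+ 2.
have normE P : projections P ->
    frobenius_norm (P - Q) ^+ 2 = c + weighted_diag r (U *m P *m U ^t*).
  move=> Pproj; rewrite sqr_frobenius_norm_sub_projection // -/H HE.
  rewrite -mxtrace_mul_real_diag; congr (_ + complex.Re _).
  by rewrite !mulmxA mxtrace_mulC !mulmxA.
(* Conjugation by U permutes the projections, so a projection found in the eigenbasis is carried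
   back to the original basis. *)
have attained v : - (\sum_(k | 0 < - r k) - r k) <= v <= \sum_(k | 0 < r k) r k ->
    exists2 P, projections P & frobenius_norm (P - Q) ^+ 2 = c + v.
  move=> /(weighted_diag_attained ra rb)[P Pproj Pv].
  have UCunit : U ^t* \is unitarymx by rewrite trmxC_unitary.
  exists (U ^t* *m P *m U).
    by have := projections_unitary_conj UCunit Pproj; rewrite trmxCK.
  rewrite normE; last by have := projections_unitary_conj UCunit Pproj; rewrite trmxCK.
  rewrite !mulmxA (unitarymxP Uunit) mul1mx -mulmxA.
  by rewrite (unitarymxP Uunit) mulmx1 Pv.
set lo := - (\sum_(k | 0 < - r k) - r k) in attained.
set hi := \sum_(k | 0 < r k) r k in attained.
have lohi : lo <= hi.
  by rewrite (le_trans _ (sum_pos_ge0 r)) // oppr_le0 sum_pos_ge0.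
(* c + lo is itself an attained squared distance. Its sign matters because [Num.sqrt] is 0 on
   negative numbers. *)
have clo_ge0 : 0 <= c + lo.
  by have [|P _ <-] := attained lo; rewrite ?lexx ?lohi ?sqr_ge0.
have norm_ge0 (A : 'M[R[i]]_n) : 0 <= frobenius_norm A by apply: sqrtr_ge0.
(* It suffices to exhibit the range as some nonempty closed interval: the endpoints are then its
   infimum and supremum. *)
apply: (@eq_itvcc_inf_sup _ _ (Num.sqrt (c + lo)) (Num.sqrt (c + hi))).
  by rewrite ler_wsqrtr // lerD2l.
apply/seteqP; split => [_ [P Pproj <-]|v] /=.
  rewrite in_itv /= -[frobenius_norm _]ger0_norm // -sqrtr_sqr normE //.
  have UPproj := projections_unitary_conj Uunit Pproj.
  rewrite !ler_wsqrtr // lerD2l ?weighted_diag_le //.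
  by rewrite lerNl -weighted_diagN weighted_diag_le.
rewrite in_itv /= => /andP[lev vle].
have v0 : 0 <= v by rewrite (le_trans _ lev) ?sqrtr_ge0.
(* Squaring the bounds on v places v ^+ 2 - c between lo and hi; the resulting distance and v are
   nonnegative with equal squares. *)
have [|P Pproj Pv] := attained (v ^+ 2 - c).
  rewrite lerBrDl [_ - c <= _]lerBlDl -(sqr_sqrtr clo_ge0).
  have /sqr_sqrtr <- : 0 <= c + hi by rewrite (le_trans clo_ge0) ?lerD2l.
  by rewrite !ler_pXn2r ?nnegrE ?sqrtr_ge0 ?lev.
exists P => //; apply/eqP; rewrite -(@eqrXn2 _ 2) //.
by rewrite Pv addrC subrK.
Qed.
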